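(* Let $G$ be a graph on $n$ vertices, and let $d$ and $m$ be positive integers with $m\le n$. Then the $d$-improper chromatic number of $G$ satisfies all four of the following inequalities: $$\chi^d(G)\ge 1+\frac{-dm+\sum_{i=1}^m\lambda_i}{dm-\sum_{i=1}^m\lambda_{n+1-i}},$$ $$\chi^d(G)\ge 1+\frac{-dm+\sum_{i=1}^m\lambda_i}{dm+\sum_{i=1}^m(\mu_i-\lambda_i)},$$ $$\chi^d(G)\ge 1+\frac{-dm+\sum_{i=1}^m\lambda_i}{dm+\sum_{i=1}^m(\lambda_i+\mu_i-\theta_i)},$$ $$\chi^d(G)\ge 1+\frac{-dm+\sum_{i=1}^m\lambda_i}{dm+\sum_{i=1}^m(\lambda_i+\mu_{n+1-i}-\theta_{n+1-i})}.$$
   Context: Graphs are finite, simple, with at least one vertex. A colouring of $G$ is $d$-improper if each vertex $v$ has at most $d$ neighbours of the same colour as $v$; $\chi^d(G)$ is the least number of colours in a $d$-improper colouring of $G$. $A$ is the adjacency matrix of $G$ and $D$ is the diagonal matrix of vertex degrees. $\lambda_1\ge\dots\ge\lambda_n$ are the eigenvalues of $A$; $\mu_1\ge\dots\ge\mu_n=0$ are the eigenvalues of the Laplacian $L=D-A$; $\theta_1\ge\dots\ge\theta_n\ge0$ are the eigenvalues of the signless Laplacian $Q=D+A$. *)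

(* Defs.v *)
From HB Require Import structures.
From mathcomp Require Import all_boot all_order all_algebra.
From mathcomp Require Import polyrcf.

Set Implicit Arguments.
Unset Strict Implicit.
Unset Printing Implicit Defensive.

Import Order.TTheory GRing.Theory Num.Theory.

Local Open Scope ring_scope.

Record sgraph := SGraph {
  vertex :> finType;
  edge : rel vertex;
  edge_sym : symmetric edge;
  edge_irrefl : irreflexive edge
}.

Section Graph.
Variable G : sgraph.

Definition degree (v : G) : nat := #|[set u : G | edge v u]|.

Definition improper_colouring (d k : nat) (c : {ffun G -> 'I_k}) : bool :=
  [forall v : G, #|[set u : G | edge v u & c u == c v]| <= d]%N.

Definition improper_colourable (d k : nat) : bool :=
  [exists c : {ffun G -> 'I_k}, improper_colouring d c].

Lemma improper_colourable_card d : improper_colourable d #|vertex G|.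
Proof.
apply/existsP; exists [ffun v => enum_rank v]; apply/forallP => v.
rewrite (_ : [set _ | _ & _] = set0) ?cards0 //.
apply/setP => u; rewrite !inE !ffunE (inj_eq enum_rank_inj).
by case: eqP => [->|_]; rewrite ?edge_irrefl ?andbF.
Qed.

Definition improper_chromatic (d : nat) : nat :=
  ex_minn (ex_intro (improper_colourable d) _ (improper_colourable_card d)).

Variable R : rcfType.

Definition adjacency : 'M[R]_#|vertex G| :=
  \matrix_(i, j) (edge (enum_val i) (enum_val j))%:R.

Definition degree_mx : 'M[R]_#|vertex G| :=
  diag_mx (\row_i (degree (enum_val i))%:R).

Definition laplacian : 'M[R]_#|vertex G| := degree_mx - adjacency.

Definition signless_laplacian : 'M[R]_#|vertex G| := degree_mx + adjacency.

End Graph.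

(* The roots in R of the characteristic polynomial, repeated according to
   multiplicity, in nonincreasing order.  For a symmetric matrix of size n
   all roots lie in R, so this list has length n. *)
Definition spectrum (R : rcfType) (n : nat) (M : 'M[R]_n) : seq R :=
  sort >=%R
    (flatten [seq nseq (mup x (char_poly M)) x | x <- rootsR (char_poly M)]).

(* The i-th largest eigenvalue, counted from i = 1; the values at i = 0 and
   at i > n carry no meaning. *)
Definition eigval (R : rcfType) (n : nat) (M : 'M[R]_n) (i : nat) : R :=
  nth 0 (spectrum M) i.-1.

(* Main.v *)
Require Import Defs.
From mathcomp Require Import all_boot all_order all_algebra.
From mathcomp Require Import perm spectral sesquilinear polyrcf complex.
From mathcomp Require Import ring lra.

Import Order.TTheory GRing.Theory Num.Theory.

(** Write <M, W> for the trace of M W.  For a symmetric M the sum of its m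
    largest (smallest) eigenvalues is the maximum (minimum) of <M, W> over the
    Fantope, the set of matrices W with 0 <= W <= 1 and trace m: this is Ky
    Fan's principle, [pairing_top], [pairing_bottom], [top_attained] and
    [bottom_attained].

    A colouring c of the index set with k colours cuts a matrix W into blocks;
    let P(W), the pinching of W, keep the monochromatic blocks and erase the
    others.  If W >= 0 then k P(W) >= W, since v = v_1 + ... + v_k with one
    summand per colour gives |v|^2 <= k (|v_1|^2 + ... + |v_k|^2) for the
    seminorm defined by W.  As P preserves the trace and fixes 1, the map
      W |-> (k P(W) - W) / (k - 1)
    therefore sends the Fantope to itself.  P is self-adjoint, so feeding these
    new members of the Fantope to Ky Fan's principle yields, for every W in the
    Fantope, [pairing_pinch_bounds]:
      (k - 1) bottom(M) <= k <P(M), W> - <M, W> <= (k - 1) top(M).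

    When c is a d-improper colouring of G, P(A) is the adjacency matrix of a
    graph of maximum degree at most d, so <P(A), W> <= d m
    ([pairing_monochromatic]), whereas P fixes the diagonal matrix D.  With S
    the sum of the m largest eigenvalues of A, each of the four estimates takes
    the form
      S <= k d m + (k - 1) X,   that is,   S - d m <= (k - 1) (d m + X),
    where d m + X is its denominator.  They come from choosing M among A, L, Q
    and W optimal for A, A, Q and L respectively ([bound_adjacency],
    [bound_laplacian], [bound_signless_top], [bound_signless_bottom]).

    To divide by d m + X one must know that it is positive.  The inequality
    itself shows this: a colouring with all colours distinct is 0-improper, so
    that S <= (k - 1) X, and S >= 0 because A has trace zero
    ([chromatic_bound]). *)

Set Implicit Arguments.
Unset Strict Implicit.
Unset Printing Implicit Defensive.

Local Open Scope ring_scope.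
Local Open Scope sesquilinear_scope.

(** * Pinching a matrix along a colouring of its indices *)

Section Pinching.
Variables (K : finType) (n : nat) (c : 'I_n -> K).

Definition pinch (T : pzRingType) (W : 'M[T]_n) : 'M[T]_n :=
  \matrix_(i, j) (W i j *+ (c i == c j)).

Variable T : pzRingType.
Implicit Types W M : 'M[T]_n.

Lemma pinchD W M : pinch (W + M) = pinch W + pinch M.
Proof. by apply/matrixP => i j; rewrite !mxE mulrnDl. Qed.

Lemma pinchN W : pinch (- W) = - pinch W.
Proof. by apply/matrixP => i j; rewrite !mxE mulNrn. Qed.

Lemma pinch_diag d : pinch (diag_mx d : 'M[T]_n) = diag_mx d.
Proof.
apply/matrixP => i j; rewrite !mxE; case: (eqVneq i j) => [->|_].
  by rewrite eqxx.
by rewrite mulr0n mul0rn.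
Qed.

Lemma pinch1 : pinch (1%:M : 'M[T]_n) = 1%:M.
Proof. by rewrite -diag_const_mx pinch_diag. Qed.

Lemma mxtrace_pinch W : \tr (pinch W) = \tr W.
Proof. by apply: eq_bigr => i _; rewrite mxE eqxx. Qed.

Lemma mxtrace_mul_pinch M W : \tr (M *m pinch W) = \tr (pinch M *m W).
Proof.
apply: eq_bigr => i _; rewrite !mxE; apply: eq_bigr => j _.
by rewrite !mxE mulrnAr mulrnAl eq_sym.
Qed.

Lemma pinch_id M : (#|K| <= 1)%N -> pinch M = M.
Proof.
move=> /fintype_le1P K1; apply/matrixP => i j.
by rewrite mxE (K1 (c i) (c j)) eqxx.
Qed.

End Pinching.

Lemma map_pinch (K : finType) (n : nat) (c : 'I_n -> K) (T U : pzRingType)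
    (f : {rmorphism T -> U}) (M : 'M[T]_n) :
  map_mx f (pinch c M) = pinch c (map_mx f M).
Proof. by apply/matrixP => i j; rewrite !mxE rmorphMn. Qed.

(** * The Fantope and Ky Fan's principle *)

Lemma natr_predS (T : pzRingType) k : (0 < k)%N -> k%:R = 1 + k.-1%:R :> T.
Proof. by move=> k0; rewrite -mulrS prednK. Qed.

Lemma sum_mul_ltn (T : pzRingType) (n m : nat) (f : nat -> T) :
  (m <= n)%N -> \sum_(i < n) f i * (i < m)%:R = \sum_(i < m) f i.
Proof.
move=> mn; rewrite (big_ord_widen n f mn) [RHS]big_mkcond /=.
by apply: eq_bigr => i _; case: ifP; rewrite ?mulr1 ?mulr0.
Qed.

Section Fantope.
Variables (C : numClosedFieldType) (n : nat).
Implicit Types (W M V : 'M[C]_n) (u v : 'rV[C]_n).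

Definition form W u v : C := (u *m W *m v^t* ) 0 0.

Definition psd W := forall u, 0 <= form W u u.

(** The convex hull of the orthogonal projections of rank m: over a closed
    field a real-valued form comes from a hermitian matrix. *)
Definition fantope m W := [/\ psd W, psd (1%:M - W) & \tr W = m%:R].

Lemma formE W u v : form W u v = \sum_i \sum_j u 0 i * W i j * (v 0 j)^*.
Proof.
rewrite /form mxE exchange_big; apply: eq_bigr => j _ /=.
by rewrite !mxE mulr_suml.
Qed.

Lemma form_suml (I : finType) W (u : I -> 'rV[C]_n) v :
  form W (\sum_a u a) v = \sum_a form W (u a) v.
Proof. by rewrite /form !mulmx_suml summxE. Qed.

Lemma form_sumr (I : finType) W u (v : I -> 'rV[C]_n) :
  form W u (\sum_a v a) = \sum_a form W u (v a).
Proof.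
rewrite /form -summxE -mulmx_sumr; congr ((_ *m _) 0 0).
by rewrite raddf_sum /= raddf_sum.
Qed.

Lemma formBl W u v w : form W (u - v) w = form W u w - form W v w.
Proof. by rewrite /form !mulmxBl !mxE. Qed.

Lemma formBr W u v w : form W w (u - v) = form W w u - form W w v.
Proof. by rewrite /form linearB /= raddfB /= mulmxBr !mxE. Qed.

Lemma form_mxB W M u v : form (W - M) u v = form W u v - form M u v.
Proof. by rewrite /form mulmxBr mulmxBl !mxE. Qed.

Lemma form_mxZ a W u v : form (a *: W) u v = a * form W u v.
Proof. by rewrite /form -scalemxAr -scalemxAl mxE. Qed.

Lemma form_delta W i j : form W (delta_mx 0 i) (delta_mx 0 j) = W i j.
Proof.
rewrite /form -rowE trmx_delta map_delta_mx -colE !mxE //.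
Qed.

Lemma psd1 : psd 1%:M.
Proof.
move=> u; rewrite /form mulmx1 mxE; apply: sumr_ge0 => i _.
by rewrite !mxE mul_conjC_ge0.
Qed.

Lemma psdZ a W : 0 <= a -> psd W -> psd (a *: W).
Proof. by move=> a0 pW u; rewrite form_mxZ mulr_ge0. Qed.

(** Complementation exchanges the largest and the smallest eigenvalues, which
    reduces the lower half of Ky Fan's principle to the upper half. *)
Lemma fantopeC m W : (m <= n)%N -> fantope m W -> fantope (n - m) (1%:M - W).
Proof.
move=> mn [p1 p2 t]; split=> //; first by rewrite opprB addrC subrK.
by rewrite linearB /= mxtrace1 t natrB.
Qed.

Lemma fantope_scalar m : (m <= n)%N -> (0 < n)%N ->
  fantope m ((m%:R / n%:R) *: 1%:M).
Proof.
move=> mn n0; have nn0 : n%:R != 0 :> C by rewrite pnatr_eq0 -lt0n.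
split.
- by apply: psdZ psd1; rewrite divr_ge0.
- suff -> : 1%:M - (m%:R / n%:R) *: 1%:M
    = (1 - m%:R / n%:R) *: (1%:M : 'M[C]_n).
    apply: psdZ psd1; rewrite subr_ge0 ler_pdivrMr ?ltr0n //.
    by rewrite mul1r ler_nat.
  by rewrite scalerBl scale1r.
- by rewrite mxtraceZ mxtrace1 divfK.
Qed.

Lemma fantope_diag m (V : 'M[C]_n) : (m <= n)%N -> V \is unitarymx ->
  fantope m (V^t* *m diag_mx (\row_i (i < m)%:R) *m V).
Proof.
move=> mn Vu; have VVs : V^t* *m V = 1%:M.
  by rewrite -invmx_unitary // mulVmx // unitarymx_unit.
have psdV (e : 'rV[C]_n) : (forall i, 0 <= e 0 i) ->
    psd (V^t* *m diag_mx e *m V).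
  move=> e0 u; pose w := u *m V^t*.
  have Ew : V *m u^t* = w^t* by rewrite trmx_mul map_mxM /= trmxCK.
  rewrite /form !mulmxA -[_ *m V *m _]mulmxA Ew mul_mx_diag mxE.
  apply: sumr_ge0 => i _; rewrite !mxE mulrAC mulr_ge0 //.
  by rewrite mul_conjC_ge0.
split.
- by apply: psdV => i; rewrite mxE.
- rewrite -VVs -{1}[V^t*]mulmx1 -mulmxBl -mulmxBr -diag_const_mx -raddfB.
  by apply: psdV => i; rewrite !mxE subr_ge0 lern1 leq_b1.
- rewrite mxtrace_mulC mulmxA (unitarymxP Vu) mul1mx mxtrace_diag.
  under eq_bigr do rewrite mxE -[_%:R]mul1r.
  by rewrite (sum_mul_ltn (fun=> 1)) // sumr_const card_ord.
Qed.

Lemma fantope_diag_form m W (V : 'M[C]_n) i : V \is unitarymx -> fantope m W ->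
  0 <= form W (row i V) (row i V) <= 1.
Proof.
move=> Vu [p1 p2 _]; rewrite p1 /= -subr_ge0.
have := p2 (row i V); rewrite form_mxB.
congr (_ <= _ - _).
by rewrite /form mulmx1 -dotmxE (row_unitarymxP Vu) eqxx.
Qed.

Lemma mxtrace_diag_form W (V : 'M[C]_n) (e : 'rV[C]_n) :
  \tr (V^t* *m diag_mx e *m V *m W)
  = \sum_i e 0 i * form W (row i V) (row i V).
Proof.
rewrite -!mulmxA mxtrace_mulC -mulmxA.
apply: eq_bigr => i _; rewrite mul_diag_mx mxE; congr (_ * _).
rewrite -form_delta /form; congr (fun_of_matrix _ 0 0).
rewrite !rowE !mulmxA -!mulmxA; do 3 congr (_ *m _).
by rewrite trmx_mul map_mxM.
Qed.

Lemma mxtrace_form W (V : 'M[C]_n) : V \is unitarymx ->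
  \sum_i form W (row i V) (row i V) = \tr W.
Proof.
move=> Vu; have := mxtrace_diag_form W V (const_mx 1).
rewrite diag_const_mx mulmx1 -invmx_unitary // mulVmx ?unitarymx_unit //.
by rewrite mul1mx => ->; apply: eq_bigr => i _; rewrite mxE mul1r.
Qed.

(** The eigenvalues are indexed by nat rather than by ordinals, so that the
    last m of them are reached by n - i.+1. *)
Definition spectral_form M (s : nat -> C) (V : 'M[C]_n) :=
  [/\ forall i j, (i <= j < n)%N -> s j <= s i,
      V \is unitarymx & M = V^t* *m diag_mx (\row_i s i) *m V].

(** In an eigenbasis the trace is the sum of the s i with weights w i between
    0 and 1 of total mass m; such a sum is largest when the whole mass sits on
    the first m indices. *)
Lemma kyfan_le M s V m W : spectral_form M s V -> (m <= n)%N ->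
  fantope m W -> \tr (M *m W) <= \sum_(i < m) s i.
Proof.
move=> [dec Vu ->] mn fW; rewrite mxtrace_diag_form.
pose w i := form W (row i V) (row i V).
have sw : \sum_i w i = m%:R by rewrite mxtrace_form //; case: fW.
rewrite -(sum_mul_ltn s mn) -subr_ge0 -sumrB.
(* Both weightings have mass m, so subtracting from every s i the threshold
   value a, the m-th largest one, changes nothing and makes the comparison
   hold term by term.  For m = 0 the threshold s 0 also serves, as it bounds
   every s i. *)
pose a := s m.-1.
suff H : 0 <= \sum_(i < n) (s i - a) * ((i < m)%:R - w i).
  have E : \sum_(i < n) a * ((i < m)%:R - w i) = 0.
    rewrite -mulr_sumr sumrB sw -[X in X - _](eq_bigr _ (fun i _ => mul1r _)).
    by rewrite (sum_mul_ltn (fun=> 1)) // sumr_const card_ord subrr mulr0.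
  rewrite -[X in _ <= X]addr0 in H; rewrite -[X in _ + X]E -big_split /= in H.
  congr (_ <= _): H.
  apply: eq_bigr => i _; rewrite mxE /w; ring.
apply: sumr_ge0 => i _.
have /andP[w0 w1] := fantope_diag_form i Vu fW.
case: (ltnP i m) => im /=.
  rewrite mulr_ge0 // subr_ge0 //; apply: dec.
  by case: m {fW sw a} mn im => // m mn; rewrite ltnS => ->.
rewrite sub0r mulrN -mulNr opprB mulr_ge0 // subr_ge0; apply: dec.
by rewrite ltn_ord andbT (leq_trans (leq_pred m)).
Qed.

Lemma kyfan_attained M s V m : spectral_form M s V -> (m <= n)%N ->
  exists2 W, fantope m W & \tr (M *m W) = \sum_(i < m) s i.
Proof.
move=> [dec Vu ->] mn.
exists (V^t* *m diag_mx (\row_i (i < m)%:R) *m V); first exact: fantope_diag.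
rewrite !mulmxA mulmxtVK // -[_ *m diag_mx _ *m diag_mx _]mulmxA mulmx_diag.
rewrite mxtrace_mulC mulmxA (unitarymxP Vu) mul1mx mxtrace_diag.
by under eq_bigr do rewrite !mxE; rewrite sum_mul_ltn.
Qed.

Lemma spectral_form_trace M s V : spectral_form M s V ->
  \tr M = \sum_(i < n) s i.
Proof.
move=> [dec Vu ->].
rewrite mxtrace_mulC mulmxA (unitarymxP Vu) mul1mx mxtrace_diag.
by apply: eq_bigr => i _; rewrite mxE.
Qed.

Lemma sum_bottom (s : nat -> C) m : (m <= n)%N ->
  \sum_(i < m) s (n - i.+1)%N = \sum_(i < n) s i - \sum_(i < n - m) s i.
Proof.
move=> mn; rewrite -(big_mkord xpredT s).
rewrite -[\sum_(i < n - m) _](big_mkord xpredT s).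
rewrite (@big_cat_nat _ _ _ (n - m) 0 n) ?leq_subr //= addrAC subrr add0r.
rewrite big_nat_rev /= -[X in index_iota X]add0n big_addn subKn // big_mkord.
by apply: eq_bigr => i _; rewrite -addSn [(_ - m + n)%N]addnC subnDr.
Qed.

Lemma kyfan_ge M s V m W : spectral_form M s V -> (m <= n)%N ->
  fantope m W -> \sum_(i < m) s (n - i.+1)%N <= \tr (M *m W).
Proof.
move=> sM mn fW; rewrite sum_bottom // -(spectral_form_trace sM).
rewrite lerBlDl -lerBlDr.
have := kyfan_le sM (leq_subr m n) (fantopeC mn fW).
by rewrite mulmxBr mulmx1 linearB.
Qed.

Lemma kyfan_bottom_attained M s V m : spectral_form M s V -> (m <= n)%N ->
  exists2 W, fantope m W & \tr (M *m W) = \sum_(i < m) s (n - i.+1)%N.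
Proof.
move=> sM mn; have [W fW E] := kyfan_attained sM (leq_subr m n).
exists (1%:M - W); first by have := fantopeC (leq_subr m n) fW; rewrite subKn.
by rewrite mulmxBr mulmx1 linearB /= E sum_bottom // (spectral_form_trace sM).
Qed.

Lemma psd_edge W i j : psd W -> W i j + W j i <= W i i + W j j.
Proof.
move=> /(_ (delta_mx 0 i - delta_mx 0 j)).
rewrite formBl !formBr !form_delta => pij; rewrite -subr_ge0.
by congr (_ <= _): pij; ring.
Qed.

(** The difference of the two sides is the trace of W against the Laplacian of
    r, which is half the sum over r of the values of the form at e_i - e_j. *)
Lemma psd_laplacian W (r : rel 'I_n) : symmetric r -> psd W ->
  \sum_i \sum_j (r i j)%:R * W i j <= \sum_i (\sum_j (r i j)%:R) * W i i.
Proof.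
move=> rs pW; under [leRHS]eq_bigr do rewrite mulr_suml.
rewrite -(ler_pM2l (ltr0n _ 2)) !mulr_natl !mulr2n.
rewrite [X in X + _ <= _]exchange_big [X in _ <= X + _]exchange_big /=.
rewrite -!big_split; apply: ler_sum => i _; rewrite -!big_split /=.
apply: ler_sum => j _; rewrite rs -!mulrDr ler_wpM2l //.
by rewrite ![W j _ + _]addrC psd_edge.
Qed.

(** For the parts p a of u supported on the colour classes, twice the form of
    [#|K| *: pinch c W - W] at u is the sum over all pairs (a, b) of the form of
    W at p a - p b. *)
Lemma psd_pinch (K : finType) (c : 'I_n -> K) W : psd W ->
  psd (#|K|%:R *: pinch c W - W).
Proof.
move=> pW u; pose p a := \row_i (u 0 i *+ (c i == a)).
have up : u = \sum_a p a.
  apply/rowP => i; rewrite summxE (bigD1 (c i)) //= mxE eqxx big1 ?addr0 //.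
  by move=> a /negPf ca; rewrite mxE eq_sym ca.
have pp : form (pinch c W) u u = \sum_a form W (p a) (p a).
  rewrite formE; under [RHS]eq_bigr do rewrite formE.
  rewrite [RHS]exchange_big; apply: eq_bigr => i _ /=.
  rewrite [RHS]exchange_big; apply: eq_bigr => j _ /=.
  rewrite (bigD1 (c i)) //= big1 => [|a /negPf ca].
    rewrite addr0 !mxE eqxx eq_sym; case: eqP => _; rewrite ?mulr1n //.
    by rewrite !mulr0n conjC0 !(mulr0, mul0r).
  by rewrite !mxE eq_sym ca mulr0n !mul0r.
rewrite form_mxB form_mxZ pp {1 2}up form_suml.
under [X in _ - X]eq_bigr do rewrite form_sumr.
rewrite -(ler_pM2l (ltr0n _ 2)) mulr0.
have : 0 <= \sum_a \sum_b form W (p a - p b) (p a - p b).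
  by apply: sumr_ge0 => a _; apply: sumr_ge0 => b _.
congr (_ <= _).
set S := \sum_a form W (p a) (p a); set X := \sum_a \sum_b _.
have E : X = \sum_a \sum_b (form W (p a) (p a) + form W (p b) (p b))
           - (\sum_a \sum_b form W (p a) (p b)
              + \sum_a \sum_b form W (p b) (p a)).
  rewrite -big_split -sumrB; apply: eq_bigr => a _ /=.
  rewrite -big_split -sumrB; apply: eq_bigr => b _ /=.
  rewrite formBl !formBr; ring.
rewrite E [X in _ - (_ + X)]exchange_big /=.
have -> : \sum_a \sum_b (form W (p a) (p a) + form W (p b) (p b))
  = #|K|%:R * S + #|K|%:R * S.
  under eq_bigr do rewrite big_split /= sumr_const -mulr_natl.
  by rewrite big_split /= -mulr_sumr sumr_const !mulr_natl.
ring.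
Qed.

(** Dividing by [#|K| - 1] restores the trace.  The upper bound by 1 is
    [psd_pinch] applied to 1 - W, because pinching fixes 1. *)
Lemma fantope_pinch (K : finType) (c : 'I_n -> K) m W : (1 < #|K|)%N ->
  fantope m W ->
  fantope m ((#|K|.-1%:R)^-1 *: (#|K|%:R *: pinch c W - W)).
Proof.
move=> K1 [p1 p2 t].
have k0 : #|K|.-1%:R != 0 :> C by rewrite pnatr_eq0; case: #|K| K1 => [|[]].
have kE := natr_predS C (ltnW K1).
split.
- by apply: psdZ (psd_pinch c p1); rewrite invr_ge0.
- have := psdZ _ (psd_pinch c p2); move=> /(_ (#|K|.-1%:R)^-1).
  rewrite invr_ge0 ler0n => /(_ isT); congr psd.
  rewrite pinchD pinchN pinch1 kE; move: (pinch c W) => P.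
  by apply/matrixP => i j; rewrite !mxE; field.
- rewrite mxtraceZ linearB /= mxtraceZ mxtrace_pinch t.
  by rewrite kE; field.
Qed.

End Fantope.

(** * Spectra of real symmetric matrices *)

Lemma char_poly_similar (T : comUnitRingType) (n : nat) (P M : 'M[T]_n) :
  P \in unitmx -> char_poly (invmx P *m M *m P) = char_poly M.
Proof.
move=> uP; rewrite /char_poly /char_poly_mx.
have PP : map_mx polyC (invmx P) *m map_mx polyC P = 1%:M.
  by rewrite -map_mxM mulVmx // map_mx1.
have -> : 'X%:M - map_mx polyC (invmx P *m M *m P)
    = map_mx polyC (invmx P) *m ('X%:M - map_mx polyC M) *m map_mx polyC P.
  rewrite mulmxBr mulmxBl !map_mxM scalar_mxC.
  by rewrite -['X%:M *m _ *m _]mulmxA PP mulmx1.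
by rewrite !det_mulmx mulrAC -det_mulmx PP det1 mul1r.
Qed.

Lemma perm_spectrum (R : rcfType) (n : nat) (M : 'M[R]_n) (t : seq R) :
  char_poly M = \prod_(x <- t) ('X - x%:P) -> perm_eq (spectrum M) t.
Proof.
move=> Mt; rewrite /spectrum perm_sort.
have p0 : char_poly M != 0 by rewrite monic_neq0 ?char_poly_monic.
apply/allP => x _ /=; apply/eqP; rewrite -[RHS]mu_prod_XsubC -Mt.
have rootsE y : (y \in rootsR (char_poly M)) = root (char_poly M) y.
  by rewrite -(roots_on_rootsR p0) inE.
have H : uniq (rootsR (char_poly M)) by exact: uniq_roots.
transitivity ((x \in rootsR (char_poly M)) * mup x (char_poly M))%N; last first.
  rewrite rootsE.
  by case: (boolP (root _ x)) => [_|/mupNroot->]; rewrite ?mul1n.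
elim: (rootsR _) H => //= y r IHr /andP[yr /IHr IH].
rewrite count_cat {}IH count_nseq in_cons /=.
by have [->|] := eqVneq x y; rewrite ?(negPf yr) ?mul0n ?addn0 //.
Qed.

Section Pairing.
Variables (R : rcfType) (n : nat).
Implicit Types M N : 'M[R]_n.
Local Notation toC := (@real_complex_def R (Phant R)).

(** The diagonalisation is by a unitary matrix over the algebraic closure R[i];
    the eigenvalues found there are real, hence are the roots in R of the
    characteristic polynomial, and a permutation of the rows sorts them. *)
Lemma real_spectral_form M : M^T = M ->
  exists V, spectral_form (map_mx toC M) (fun i => toC (eigval M i.+1)) V.
Proof.
move=> Msym; set A := map_mx toC M.
have Areal : A \is a realmx.
  by apply/mxOverP => i j; rewrite mxE; apply/complex_realP; exists (M i j).
have Aherm : A \is hermsymmx.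
  apply: realsym_hermsym Areal.
  apply/is_hermitianmxP; rewrite scale1r; apply/matrixP => i j.
  by rewrite !mxE -[in LHS]Msym mxE.
have /orthomx_spectralP := hermitian_normalmx Aherm.
have /mxOverP Dreal := hermitian_spectral_diag_real Aherm.
have := spectral_unitarymx A; move: (spectralmx A) (spectral_diag A) Dreal.
move=> P D Dreal Pu AE.
have [t Dt] : exists t : n.-tuple R, forall i, D 0 i = toC (tnth t i).
  exists [tuple complex.Re (D 0 i) | i < n] => i.
  by rewrite tnth_mktuple RRe_real.
have Mt : char_poly M = \prod_(x <- t) ('X - x%:P).
  apply: (map_poly_inj toC); rewrite map_char_poly -/A AE.
  rewrite char_poly_similar ?unitarymx_unit //.
  rewrite char_poly_trig ?diag_mx_is_trig // rmorph_prod /= big_tuple.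
  apply: eq_bigr => i _.
  by rewrite map_polyXsubC !mxE eqxx mulr1n Dt.
have /tuple_permP[p sp] := perm_spectrum Mt.
have eigE (i : 'I_n) : toC (eigval M i.+1) = D 0 (p i).
  rewrite Dt /eigval sp; congr toC.
  by rewrite -[RHS](tnth_mktuple (fun i => tnth t (p i)) i) (tnth_nth 0).
exists (row_perm p P); split.
- move=> i j /andP[ij jn]; rewrite lecR /eigval /=.
  have sz : size (spectrum M) = n by rewrite sp size_tuple.
  have srt : sorted >=%R (spectrum M) by apply: sort_sorted ge_total _.
  apply: (sorted_leq_nth ge_trans ge_refl 0 srt) => //; rewrite inE sz //.
  exact: leq_ltn_trans ij jn.
- have row_pP i : row i (row_perm p P) = row (p i) P.
    by apply/rowP => j; rewrite !mxE.
  apply/row_unitarymxP => i j; rewrite !row_pP.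
  by rewrite (row_unitarymxP Pu) (inj_eq perm_inj).
- rewrite AE invmx_unitary //; apply/matrixP => a b.
  rewrite !mul_mx_diag !mxE (reindex_inj (@perm_inj _ p)) /=.
  by apply: eq_bigr => i _; rewrite !mxE -eigE.
Qed.

(** Taking the real part brings every inequality between traces, proved with
    complex W, back to the ordered field R. *)
Definition pairing M (W : 'M[R[i]]_n) : R :=
  complex.Re (\tr (map_mx toC M *m W)).

Lemma pairingD M N W : pairing (M + N) W = pairing M W + pairing N W.
Proof. by rewrite /pairing map_mxD mulmxDl !raddfD. Qed.

Lemma pairingN M W : pairing (- M) W = - pairing M W.
Proof. by rewrite /pairing map_mxN mulNmx !raddfN. Qed.

Lemma pairing_le M W x : \tr (map_mx toC M *m W) <= toC x -> pairing M W <= x.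
Proof. by rewrite lecE => /andP[]. Qed.

Lemma pairing_ge M W x : toC x <= \tr (map_mx toC M *m W) -> x <= pairing M W.
Proof. by rewrite lecE => /andP[]. Qed.

Definition top_sum M m : R := \sum_(i < m) eigval M i.+1.
Definition bottom_sum M m : R := \sum_(i < m) eigval M (n - i.+1).+1.

Section KyFan.
Variables (M : 'M[R]_n) (m : nat).
Hypotheses (Msym : M^T = M) (mn : (m <= n)%N).

Lemma pairing_top W : fantope m W -> pairing M W <= top_sum M m.
Proof.
have [V sV] := real_spectral_form Msym => fW.
by apply: pairing_le; rewrite rmorph_sum; exact: (kyfan_le sV).
Qed.

Lemma pairing_bottom W : fantope m W -> bottom_sum M m <= pairing M W.
Proof.
have [V sV] := real_spectral_form Msym => fW.
by apply: pairing_ge; rewrite rmorph_sum; exact: (kyfan_ge sV).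
Qed.

Lemma top_attained : exists2 W, fantope m W & pairing M W = top_sum M m.
Proof.
have [V /kyfan_attained-/(_ _ mn)[W fW E]] := real_spectral_form Msym.
by exists W => //; rewrite /pairing E -rmorph_sum.
Qed.

Lemma bottom_attained : exists2 W, fantope m W & pairing M W = bottom_sum M m.
Proof.
have [V /kyfan_bottom_attained-/(_ _ mn)[W fW E]] := real_spectral_form Msym.
by exists W => //; rewrite /pairing E -rmorph_sum.
Qed.

Variables (K : finType) (c : 'I_n -> K).

(** Ky Fan's principle for the element of the Fantope given by [fantope_pinch].
    The form without division also covers a single colour, where all three
    sides vanish. *)
Lemma pairing_pinch_bounds W : (0 < #|K|)%N -> fantope m W ->
  #|K|.-1%:R * bottom_sum M m
    <= #|K|%:R * pairing (pinch c M) W - pairing M W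
    <= #|K|.-1%:R * top_sum M m.
Proof.
move=> K0 fW; have [K1|K1] := leqP #|K| 1.
  have -> : #|K| = 1%N by apply/eqP; rewrite eqn_leq K1.
  by rewrite pinch_id // !mul0r mul1r subrr lexx.
have fZ := fantope_pinch c K1 fW.
have k0 : 0 < #|K|.-1%:R :> R by rewrite ltr0n; case: #|K| K1 => [|[]].
suff E : pairing M (#|K|.-1%:R^-1 *: (#|K|%:R *: pinch c W - W))
    = #|K|.-1%:R^-1 * (#|K|%:R * pairing (pinch c M) W - pairing M W).
  have := pairing_top fZ; have := pairing_bottom fZ.
  by rewrite E ler_pdivlMl // ler_pdivrMl // => -> ->.
rewrite /pairing -scalemxAr mulmxBr -scalemxAr.
rewrite mxtraceZ linearB /= mxtraceZ mxtrace_mul_pinch map_pinch.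
set x := \tr _; set y := \tr _.
rewrite -(rmorph_nat toC) -(rmorph_nat toC) -fmorphV /=.
by case: x y => [x x'] [y y']; simpc.
Qed.

End KyFan.

(** The sum of the m largest eigenvalues is at least m / n times the trace, as
    the scalar matrix m / n belongs to the Fantope. *)
Lemma top_sum_ge0 M m : M^T = M -> (m <= n)%N -> \tr M = 0 -> 0 <= top_sum M m.
Proof.
move=> Ms mn tM; case: (posnP n) => [n0|n0].
  have m0 : m = 0%N by apply/eqP; rewrite -leqn0 -n0.
  by rewrite /top_sum m0 big_ord0.
suff <- : pairing M (m%:R / n%:R *: 1%:M) = 0.
  exact/pairing_top/fantope_scalar.
by rewrite /pairing -scalemxAr mulmx1 mxtraceZ trace_map_mx tM rmorph0 mulr0.
Qed.

End Pairing.

(** * Adjacency matrices against the Fantope *)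

Section RelationMatrix.
Variables (R : rcfType) (n : nat) (r : rel 'I_n).
Hypothesis r_sym : symmetric r.

Definition rel_mx : 'M[R]_n := \matrix_(i, j) (r i j)%:R.
Definition out_degree_mx : 'M[R]_n := diag_mx (\row_i (\sum_j r i j)%N%:R).

Lemma pairing_diag (e : 'rV[R]_n) (W : 'M[R[i]]_n) :
  pairing (diag_mx e) W = \sum_i e 0 i * complex.Re (W i i).
Proof.
rewrite /pairing map_diag_mx raddf_sum; apply: eq_bigr => i _.
by rewrite mul_diag_mx !mxE; case: (W i i) => a b; simpc.
Qed.

Lemma pairing_rel_mx_le W :
  psd W -> pairing rel_mx W <= pairing out_degree_mx W.
Proof.
move=> /(psd_laplacian r_sym); rewrite lecE => /andP[_].
congr (_ <= _).
  rewrite /pairing exchange_big; congr (complex.Re _); apply: eq_bigr => i _.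
  by rewrite mxE; apply: eq_bigr => j _; rewrite !mxE rmorph_nat r_sym.
rewrite pairing_diag raddf_sum; apply: eq_bigr => i _.
rewrite mxE -natr_sum -(rmorph_nat (real_complex R)) /=.
by case: (W i i) => a b; simpc.
Qed.

Lemma pairing_rel_mx_degree d m W : (forall i, \sum_j r i j <= d)%N ->
  fantope m W -> pairing rel_mx W <= d%:R * m%:R.
Proof.
move=> rd [pW _ tW]; apply: (le_trans (pairing_rel_mx_le pW)).
have -> : m%:R = \sum_i complex.Re (W i i) :> R.
  by rewrite -raddf_sum /= -/(\tr W) tW -(rmorph_nat (real_complex R)).
rewrite pairing_diag mulr_sumr; apply: ler_sum => i _.
rewrite mxE ler_wpM2r ?ler_nat //.
by have := pW (delta_mx 0 i); rewrite form_delta lecE => /andP[].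
Qed.

End RelationMatrix.

(** * Improper colourings and eigenvalue sums *)

Section Graph.
Variables (R : rcfType) (G : sgraph).
Local Notation A := (adjacency G R).
Local Notation D := (degree_mx G R).
Local Notation L := (laplacian G R).
Local Notation Q := (signless_laplacian G R).
Local Notation N := #|vertex G|.

Lemma adjacency_sym : A^T = A.
Proof. by apply/matrixP => i j; rewrite !mxE edge_sym. Qed.

Lemma laplacian_sym : L^T = L.
Proof. by rewrite linearB /= tr_diag_mx adjacency_sym. Qed.

Lemma signless_laplacian_sym : Q^T = Q.
Proof. by rewrite linearD /= tr_diag_mx adjacency_sym. Qed.

Lemma adjacency_trace : \tr A = 0.
Proof. by apply: big1 => i _; rewrite mxE edge_irrefl. Qed.

Lemma sum_enum_val (P : pred G) : (\sum_(j < N) P (enum_val j) = #|P|)%N.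
Proof.
rewrite -sum1_card [RHS]big_mkcond (reindex _ (onW_bij _ (@enum_val_bij G))) /=.
by apply: eq_bigr => i _; rewrite unfold_in; case: (P _).
Qed.

Definition edge_ord : rel 'I_N := fun i j => edge (enum_val i) (enum_val j).

Lemma degree_mxE : D = out_degree_mx R edge_ord.
Proof.
congr diag_mx; apply/rowP => i; rewrite !mxE; congr (_%:R).
by rewrite sum_enum_val /degree cardsE.
Qed.

Lemma pairing_adjacency_le W : psd W -> pairing A W <= pairing D W.
Proof.
rewrite degree_mxE; apply: pairing_rel_mx_le => i j; exact: edge_sym.
Qed.

Section Colouring.
Variables (d k m : nat) (c : {ffun G -> 'I_k}).
Hypotheses (c_improper : improper_colouring d c) (k0 : (0 < k)%N).
Hypothesis (mN : (m <= N)%N).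

Let cv (i : 'I_N) : 'I_k := c (enum_val i).

(** The pinched adjacency matrix is that of the graph of monochromatic edges,
    whose degrees are at most d. *)
Lemma pairing_monochromatic W : fantope m W ->
  pairing (pinch cv A) W <= d%:R * m%:R.
Proof.
have -> : pinch cv A = rel_mx R (fun i j => edge_ord i j && (cv i == cv j)).
  by apply/matrixP => i j; rewrite !mxE -mulrnA mulnb.
apply: pairing_rel_mx_degree => [i j|i].
  by rewrite /edge_ord edge_sym eq_sym.
rewrite (sum_enum_val (fun u => edge (enum_val i) u && (cv i == c u))).
have /forallP/(_ (enum_val i)) := c_improper; apply: leq_trans.
rewrite cardsE; apply: eq_leq; apply: eq_card => u.
by rewrite !unfold_in /= [c u == _]eq_sym.
Qed.

Local Notation S := (top_sum A m).
Local Notation bounded_by X :=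
  (S <= k%:R * (d%:R * m%:R) + k.-1%:R * X).

(** W is optimal for A, so its pairing with A is the left-hand side. *)
Lemma bound_adjacency : bounded_by (- bottom_sum A m).
Proof.
have [W fW <-] := top_attained adjacency_sym mN.
have := pairing_pinch_bounds adjacency_sym mN cv _ fW.
rewrite card_ord k0 => /(_ isT)/andP[+ _].
have := ler_wpM2l (ler0n R k) (pairing_monochromatic fW); lra.
Qed.

(** The upper half of [pairing_pinch_bounds] for D - A, with D unaffected by
    the pinching. *)
Lemma pinch_laplacian_le W : fantope m W ->
  k.-1%:R * pairing D W - k%:R * pairing (pinch cv A) W + pairing A W
    <= k.-1%:R * top_sum L m.
Proof.
move=> fW; have := pairing_pinch_bounds laplacian_sym mN cv _ fW.
rewrite card_ord k0 => /(_ isT)/andP[_].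
by rewrite pinchD pinchN pinch_diag !pairingD !pairingN (natr_predS R k0); lra.
Qed.

(** W is again optimal for A; positivity of L bounds the pairing with D below
    by the pairing with A. *)
Lemma bound_laplacian : bounded_by (top_sum L m - top_sum A m).
Proof.
have [W fW WE] := top_attained adjacency_sym mN.
have := pinch_laplacian_le fW; rewrite WE.
have [pW _ _] := fW.
have := ler_wpM2l (ler0n R k.-1) (pairing_adjacency_le pW); rewrite WE.
have := ler_wpM2l (ler0n R k) (pairing_monochromatic fW); lra.
Qed.

(** W is optimal for Q, which determines the pairing with D as the eigenvalue
    sum of Q minus <A, W>.  What is left contains <A, W> with coefficient k - 2,
    and <A, W> can be replaced by its maximum when k >= 2; a single colour is a
    case of [bound_adjacency]. *)
Lemma bound_signless_top :
  bounded_by (top_sum A m + top_sum L m - top_sum Q m).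
Proof.
have [k1|k1] := eqVneq k 1%N.
  by have := bound_adjacency; rewrite k1 /= !mul0r.
have [W fW] := top_attained signless_laplacian_sym mN.
rewrite pairingD; have := pinch_laplacian_le fW.
have := ler_wpM2l (ler0n R k) (pairing_monochromatic fW).
have k2 : 0 <= k.-2%:R :> R by [].
have := ler_wpM2l k2 (pairing_top adjacency_sym mN fW).
have k1_gt0 : (0 < k.-1)%N by case: k k0 k1 => [|[]].
rewrite (natr_predS R k1_gt0).
move: (pairing A W) (pairing D W) (pairing _ W) => a b x H1 H2 H3 <-; lra.
Qed.

(** W minimises <L, W>, which determines the pairing with D as the eigenvalue
    sum of L plus <A, W>; the lower half of [pairing_pinch_bounds] for Q leaves
    <A, W> with the same coefficient k - 2. *)
Lemma bound_signless_bottom :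
  bounded_by (top_sum A m + bottom_sum L m - bottom_sum Q m).
Proof.
have [k1|k1] := eqVneq k 1%N.
  by have := bound_adjacency; rewrite k1 /= !mul0r.
have [W fW] := bottom_attained laplacian_sym mN.
rewrite pairingD pairingN.
have := pairing_pinch_bounds signless_laplacian_sym mN cv _ fW.
rewrite card_ord k0 => /(_ isT)/andP[+ _].
rewrite pinchD pinch_diag !pairingD.
have := ler_wpM2l (ler0n R k) (pairing_monochromatic fW).
have k2 : 0 <= k.-2%:R :> R by [].
have := ler_wpM2l k2 (pairing_top adjacency_sym mN fW).
rewrite (natr_predS R k0).
have k1_gt0 : (0 < k.-1)%N by case: k k0 k1 => [|[]].
rewrite (natr_predS R k1_gt0).
move: (pairing A W) (pairing D W) (pairing _ W) => a b x H1 H2 H3 <-; lra.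
Qed.

End Colouring.

(** The hypothesis is used twice: for an optimal colouring, and for one with
    all colours distinct, which forces X >= 0.  The latter has one colour more
    than there are vertices, so that k - 1 > 0 even for a single vertex. *)
Lemma chromatic_bound (d m : nat) (X : R) :
  (0 < d)%N -> (0 < m)%N -> (m <= N)%N ->
  (forall e k (c : {ffun G -> 'I_k}), improper_colouring e c -> (0 < k)%N ->
     top_sum A m <= k%:R * (e%:R * m%:R) + k.-1%:R * X) ->
  1 + (- (d%:R * m%:R) + top_sum A m) / (d%:R * m%:R + X)
    <= (improper_chromatic G d)%:R.
Proof.
move=> d0 m0 mN H; have N0 : (0 < N)%N by exact: leq_trans mN.
have X0 : 0 <= X.
  pose c := [ffun v : G => widen_ord (leqnSn N) (enum_rank v)].
  have : improper_colouring 0 c.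
    apply/forallP => v; rewrite (_ : [set _ | _ & _] = set0) ?cards0 //.
    apply/setP => u; rewrite !inE !ffunE -val_eqE /= val_eqE.
    rewrite (inj_eq enum_rank_inj).
    by case: eqP => [->|_]; rewrite ?edge_irrefl ?andbF.
  move=> /H/(_ isT); rewrite mul0r mulr0 add0r /=.
  move=> /(le_trans (top_sum_ge0 adjacency_sym mN adjacency_trace)).
  by rewrite pmulr_rge0 // ltr0n.
rewrite /improper_chromatic; case: ex_minnP => k /existsP[c cP] _.
have k0 : (0 < k)%N.
  by case: k c {cP} => // c; have /card_gt0P[v _] := N0; case: (c v).
have := H _ _ _ cP k0.
have dm0 : 0 < d%:R * m%:R :> R by rewrite mulr_gt0 ?ltr0n.
rewrite (natr_predS R k0) lerD2l => HS; rewrite ler_pdivrMr; lra.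
Qed.

End Graph.

Theorem theorem15 (R : rcfType) (G : sgraph) (n d m : nat)
    (hn : #|vertex G| = n) (hd : (0 < d)%N) (hm : (0 < m)%N) (hmn : (m <= n)%N) :
  let lam (i : nat) : R := eigval (adjacency G R) i in
  let mu (i : nat) : R := eigval (laplacian G R) i in
  let theta (i : nat) : R := eigval (signless_laplacian G R) i in
  let chi : R := (improper_chromatic G d)%:R in
  let dm : R := d%:R * m%:R in
  [/\ chi >= 1 + (- dm + \sum_(1 <= i < m.+1) lam i)
                 / (dm - \sum_(1 <= i < m.+1) lam (n + 1 - i)%N),
      chi >= 1 + (- dm + \sum_(1 <= i < m.+1) lam i)
                 / (dm + \sum_(1 <= i < m.+1) (mu i - lam i)),
      chi >= 1 + (- dm + \sum_(1 <= i < m.+1) lam i)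
                 / (dm + \sum_(1 <= i < m.+1) (lam i + mu i - theta i)) &
      chi >= 1 + (- dm + \sum_(1 <= i < m.+1) lam i)
                 / (dm + \sum_(1 <= i < m.+1)
                           (lam i + mu (n + 1 - i)%N - theta (n + 1 - i)%N))].
Proof.
subst n => lam mu theta chi dm; rewrite {}/lam {}/mu {}/theta.
have topE (M : 'M[R]_#|vertex G|) :
    \sum_(1 <= i < m.+1) eigval M i = top_sum M m.
  by rewrite big_add1 big_mkord.
have botE (M : 'M[R]_#|vertex G|) :
    \sum_(1 <= i < m.+1) eigval M (#|vertex G| + 1 - i)%N = bottom_sum M m.
  rewrite big_add1 big_mkord; apply: eq_bigr => i _.
  by rewrite addn1 subSS subnSK // (leq_trans (ltn_ord i)).
rewrite !(big_split, sumrN) /= !topE !botE.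
split; apply: chromatic_bound => // e k c ce k0.
- exact: (bound_adjacency _ ce k0 hmn).
- exact: (bound_laplacian _ ce k0 hmn).
- exact: (bound_signless_top _ ce k0 hmn).
- exact: (bound_signless_bottom _ ce k0 hmn).
Qed.
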